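(* There is a function $\rho:(0,1)\to\mathbb{R}^+$ with $\rho(\varepsilon)<\varepsilon$ for all $\varepsilon$ such that each of the real spaces $Y=\ell_1^n$ ($n\in\mathbb{N}$) and $Y=\ell_1$ satisfies the following condition with this same function $\rho$: there is a $1$-norming subset $B\subset S_{Y^*}$ such that for every $0<\varepsilon<1$, every $(y_i)_{i\le4}\in M_Y^4$, every nonempty $A\subset\{1,2,3,4\}$ and every $y^*\in B$ satisfying $y^*(y_i)>1-\rho(\varepsilon)$ for each $i\in A$, there exists $(z_i)_{i\le 4}\in M_Y^4$ with $\|z_i-y_i\|<\varepsilon$ for every $i\le 4$ and $\|\sum_{i\in A}z_i\|=|A|$. As a consequence, there is a function $\gamma:(0,1)\to\mathbb{R}^+$ such that all the spaces $\ell_1^n$ ($n\in\mathbb{N}$) and $\ell_1$ have the approximate hyperplane sum property for $\ell_\infty^4$ (AHSp-$\ell_\infty^4$) with this same function $\gamma$.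
   Context: All spaces are real. $\ell_1^n$ is $\mathbb{R}^n$ with the $\ell_1$-norm. $B_Y$, $S_Y$, $Y^*$ denote the closed unit ball, unit sphere and topological dual of $Y$. A subset $B\subset B_{Y^*}$ is $1$-norming if $\|y\|=\sup\{|y^*(y)|:y^*\in B\}$ for each $y\in Y$. $M_Y^4=\{(y_i)_{i\le 4}\in (B_Y)^4: y_{i_1}-y_{i_2}+y_{i_3}\in B_Y \text{ for all } 1\le i_1<i_2<i_3\le 4\}$. $Y$ has the AHSp-$\ell_\infty^4$ with the function $\gamma:(0,1)\to\mathbb{R}^+$, where $0<\gamma(\varepsilon)<\varepsilon$, if for every $0<\varepsilon<1$ and every $(y_i)_{i\le 4}\in M_Y^4$: whenever there exist a nonempty $A\subset\{1,2,3,4\}$ and $y^*\in S_{Y^*}$ with $y^*(y_i)>1-\gamma(\varepsilon)$ for each $i\in A$, there exists $(z_i)_{i\le 4}\in M_Y^4$ with $\|z_i-y_i\|<\varepsilon$ for every $i\le 4$ and $\|\sum_{i\in A}z_i\|=|A|$. *)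

(* Defs.v *)
From HB Require Import structures.
From mathcomp Require Import all_boot all_order all_algebra.
From mathcomp Require Import all_classical all_reals all_analysis.

Set Implicit Arguments.
Unset Strict Implicit.
Unset Printing Implicit Defensive.

Import Order.TTheory GRing.Theory Num.Theory.
Import numFieldNormedType.Exports.

Local Open Scope classical_set_scope.
Local Open Scope ring_scope.

Section AHSp.
Context {R : realType}.

Section Dual.
Variable Y : normedModType R.

Definition unit_ball : set Y := [set y | `|y| <= 1].

(* For a continuous functional this is the supremum of a nonempty bounded set,
   so the default value of [sup] is not reached. *)
Definition dual_norm (f : {linear Y -> R}) : R :=
  sup [set `|f y| | y in unit_ball].

Definition dual_ball : set {linear Y -> R} :=
  [set f : {linear Y -> R} | continuous f /\ dual_norm f <= 1].

Definition dual_sphere : set {linear Y -> R} :=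
  [set f : {linear Y -> R} | continuous f /\ dual_norm f = 1].

Definition one_norming (B : set {linear Y -> R}) : Prop :=
  B `<=` dual_ball /\ forall y : Y, `|y| = sup [set `|f y| | f in B].

End Dual.

Section Property.
Variable Y : normedModType R.

Definition M4 : set ('I_4 -> Y) :=
  [set y | (forall i, unit_ball (y i)) /\
           (forall i1 i2 i3 : 'I_4, (i1 < i2 < i3)%N ->
              unit_ball (y i1 - y i2 + y i3))].

Definition approx_hyperplane_sum (D : set {linear Y -> R}) (rho : R -> R) :
    Prop :=
  forall e : R, 0 < e < 1 ->
  forall y : 'I_4 -> Y, M4 y ->
  forall A : {set 'I_4}, A != finset.set0 ->
  forall f : {linear Y -> R}, D f ->
  (forall i, i \in A -> f (y i) > 1 - rho e) ->
  exists z : 'I_4 -> Y,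
    [/\ M4 z, (forall i, `|z i - y i| < e) &
        `|\sum_(i in A) z i| = #|A|%:R].

Definition norming_approx_hyperplane_sum (rho : R -> R) : Prop :=
  exists B : set {linear Y -> R},
    [/\ B `<=` dual_sphere (Y := Y), one_norming B &
        approx_hyperplane_sum B rho].

Definition AHSp_linfty4 (gamma : R -> R) : Prop :=
  (forall e : R, 0 < e < 1 -> 0 < gamma e < e) /\
  approx_hyperplane_sum (dual_sphere (Y := Y)) gamma.

End Property.
End AHSp.

Arguments M4 {R} Y.
Arguments norming_approx_hyperplane_sum {R} Y rho.
Arguments AHSp_linfty4 {R} Y gamma.

(* An alias is needed because the canonical norm of ['rV[R]_n] is the
   sup norm. *)
Definition ell1n (R : realType) (n : nat) : Type := 'rV[R]_n.

Section Ell1n.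
Variables (R : realType) (n : nat).

HB.instance Definition _ := GRing.Lmodule.copy (ell1n R n) 'rV[R]_n.

Definition ell1n_norm (x : ell1n R n) : R := \sum_(i < n) `|x ord0 i|.

Lemma ell1n_normD x y : ell1n_norm (x + y) <= ell1n_norm x + ell1n_norm y.
Proof.
rewrite /ell1n_norm -big_split/=; apply: ler_sum => i _.
by rewrite mxE ler_normD.
Qed.

Lemma ell1n_normZ (a : R) x : ell1n_norm (a *: x) = `|a| * ell1n_norm x.
Proof.
by rewrite /ell1n_norm mulr_sumr; apply: eq_bigr => i _; rewrite mxE normrM.
Qed.

Lemma ell1n_norm0_eq0 x : ell1n_norm x = 0 -> x = 0.
Proof.
move=> x0; apply/rowP => i; rewrite mxE; apply/eqP; rewrite -normr_eq0.
have /psumr_eq0P : forall j : 'I_n, true -> 0 <= `|x ord0 j| by [].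
by move=> /(_ x0 i isT) ->.
Qed.

HB.instance Definition _ := Lmodule_isNormed.Build R (ell1n R n)
  ell1n_normD ell1n_normZ ell1n_norm0_eq0.

Lemma ell1n_normE (x : ell1n R n) : `|x| = \sum_(i < n) `|x ord0 i|.
Proof. by []. Qed.

End Ell1n.

Definition abs_summable (R : realType) : {pred (nat -> R)} :=
  fun u => `[< cvgn [series `|u k|]_k >].
Arguments abs_summable {R} u : simpl never.

Record ell1 (R : realType) : Type := Ell1 {
  ell1_val :> nat -> R ;
  _ : ell1_val \in abs_summable }.

Section Ell1.
Variable R : realType.

Lemma abs_summableP (u : nat -> R) :
  reflect (cvgn [series `|u k|]_k) (u \in abs_summable).
Proof. exact: asboolP. Qed.

Lemma abs_summable_submod_closed : submod_closed (@abs_summable R).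
Proof.
split=> [|a u v /abs_summableP cu /abs_summableP cv]; apply/abs_summableP.
  rewrite [X in cvgn X](_ : _ = cst 0); first exact: is_cvg_cst.
  by apply/funext => n; rewrite seriesEnat/= big1// => i _; rewrite normr0.
apply: (@series_le_cvg _ _ (fun k => `|a| * `|u k| + `|v k|)) => [k|k|k|].
- exact: normr_ge0.
- by rewrite addr_ge0// mulr_ge0.
- by rewrite (le_trans (ler_normD _ _))// lerD2r normrM.
- by apply: is_cvg_seriesD => //; exact: is_cvg_seriesZ.
Qed.

HB.instance Definition _ := GRing.isSubmodClosed.Build R (nat -> R)
  (@abs_summable R) abs_summable_submod_closed.
HB.instance Definition _ := [isSub for @ell1_val R].
HB.instance Definition _ := [Choice of ell1 R by <:].
HB.instance Definition _ := [SubChoice_isSubLmodule of ell1 R by <:].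

Definition ell1_norm (x : ell1 R) : R := limn [series `|x k|]_k.

Lemma ell1_cvg (x : ell1 R) : cvgn [series `|x k|]_k.
Proof. exact/abs_summableP/(valP x). Qed.

Lemma ell1_normD x y : ell1_norm (x + y) <= ell1_norm x + ell1_norm y.
Proof.
rewrite /ell1_norm -lim_seriesD; [|exact: ell1_cvg..].
apply: lim_series_le; [exact: ell1_cvg| |by move=> n; exact: ler_normD].
by apply: is_cvg_seriesD; exact: ell1_cvg.
Qed.

Lemma ell1_normZ (a : R) x : ell1_norm (a *: x) = `|a| * ell1_norm x.
Proof.
rewrite /ell1_norm -[RHS]/(`|a| *: _) -lim_seriesZ; last exact: ell1_cvg.
by congr (limn (series _)); apply/funext => n /=; rewrite normrM.
Qed.

Lemma ell1_norm0_eq0 x : ell1_norm x = 0 -> x = 0.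
Proof.
move=> x0; apply/val_inj/funext => k.
change (x k = 0); apply/eqP; rewrite -normr_eq0.
have nd : nondecreasing_seq [series `|x k|]_k.
  by apply: nondecreasing_series => n _ _; exact: normr_ge0.
have := nondecreasing_cvgn_le nd (@ell1_cvg x) k.+1.
rewrite -/(ell1_norm x) x0 seriesEnat/= big_nat_recr//= => xk.
rewrite eq_le normr_ge0 andbT (le_trans _ xk)// lerDr.
by apply: sumr_ge0 => i _; exact: normr_ge0.
Qed.

HB.instance Definition _ := Lmodule_isNormed.Build R (ell1 R)
  ell1_normD ell1_normZ ell1_norm0_eq0.

Lemma ell1_normE (x : ell1 R) : `|x| = limn [series `|x k|]_k.
Proof. by []. Qed.

End Ell1.

(* Main.v *)
Require Import Defs.
From HB Require Import structures.
From mathcomp Require Import all_boot all_order all_algebra.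
From mathcomp Require Import all_classical all_reals all_analysis.
From mathcomp Require Import ring lra.

Import Order.TTheory GRing.Theory Num.Theory.
Import numFieldNormedType.Exports.

Local Open Scope ring_scope.

(* The hypothesis f (y i) > 1 - rho for i in A forces |sum_(i in A) y i| to be
   close to its maximal value |A|, so it suffices to perturb y into a tuple
   attaining that value, and the whole dual sphere serves as the norming set.
   In a space with compact unit ball the perturbation exists by compactness of
   M4. To make it uniform in the dimension, the coordinates of ell_1^n at which
   (y 1, ..., y 4) points in nearly the same direction are merged: summing over
   blocks is a norm-one map onto ell_1^N with N depending on epsilon only, it
   does not change the norm of sum_(i in A) y i, and it has a linear isometry as
   an approximate inverse on the y i. Truncation reduces ell_1 to ell_1^n. *)

(** * Perturbing almost maximal tuples, and transfer between spaces *)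

Definition perturbable {R : realType} (Y : normedModType R) (e d : R)
    (A : {set 'I_4}) : Prop :=
  forall y : 'I_4 -> Y, M4 Y y ->
  #|A|%:R - d < `|\sum_(i in A) y i| ->
  exists z : 'I_4 -> Y,
    [/\ M4 Y z, (forall i, `|z i - y i| < e) &
        `|\sum_(i in A) z i| = #|A|%:R].

Lemma perturbable_le {R : realType} {Y : normedModType R} {e : R} (d d' : R)
    (A : {set 'I_4}) :
  d' <= d -> perturbable Y e d A -> perturbable Y e d' A.
Proof.
move=> dd' H y My Ay; apply: H => //.
by rewrite (le_lt_trans _ Ay)// lerB.
Qed.

Lemma M4_sum_le {R : realType} {Y : normedModType R} (y : 'I_4 -> Y)
    (A : {set 'I_4}) : M4 Y y -> `|\sum_(i in A) y i| <= #|A|%:R.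
Proof.
move=> [y1 _]; rewrite (le_trans (ler_norm_sum _ _ _))// -sum1_card natr_sum.
by apply: ler_sum => i _; exact: y1.
Qed.

Lemma M4_comp {R : realType} {Y Z : normedModType R} (T : {linear Y -> Z})
    (y : 'I_4 -> Y) :
  (forall x, `|T x| <= `|x|) -> M4 Y y -> M4 Z (T \o y).
Proof.
move=> T1 [y1 y3]; split=> [i|i1 i2 i3 i123] /=.
  by rewrite /unit_ball/= (le_trans (T1 _))//; exact: y1.
by rewrite /unit_ball/= -linearB -linearD (le_trans (T1 _))//; exact: y3.
Qed.

(** The tuple is carried to [X] by [Q], perturbed there and brought back by the isometry [J]; the
    error made in [X] adds to the distance [e'] between [J (Q (y i))] and [y i]. *)
Lemma perturb_via {R : realType} {X Y : normedModType R}
    (Q : {linear Y -> X}) (J : {linear X -> Y}) (d e e' : R)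
    (A : {set 'I_4}) (y : 'I_4 -> Y) :
  (forall x, `|Q x| <= `|x|) -> (forall a, `|J a| = `|a|) ->
  perturbable X e d A -> M4 Y y ->
  #|A|%:R - d < `|Q (\sum_(i in A) y i)| ->
  (forall i, `|J (Q (y i)) - y i| < e') ->
  exists z : 'I_4 -> Y,
    [/\ M4 Y z, (forall i, `|z i - y i| < e + e') &
        `|\sum_(i in A) z i| = #|A|%:R].
Proof.
move=> Q1 J1 HX My Ay JQ.
have [|z [Mz zy Az]] := HX _ (M4_comp _ _ Q1 My).
  by rewrite linear_sum in Ay.
exists (J \o z); split => [|i|].
- by apply: M4_comp => // a; rewrite J1.
- rewrite /= -(subrK (J (Q (y i))) (J (z i))) -addrA.
  rewrite (le_lt_trans (ler_normD _ _))// ltrD//.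
  by rewrite -linearB J1; exact: zy.
- by rewrite /= -linear_sum J1.
Qed.

Lemma finite_uniform_bound {R : realType} {T : finType} (P : T -> R -> Prop) :
  (forall t d d', d' <= d -> P t d -> P t d') ->
  (forall t, exists2 d, 0 < d & P t d) ->
  exists2 d, 0 < d & forall t, P t d.
Proof.
move=> Pmono /(_ _)/cid2-/all_sig2[d d0 Pd].
exists (\big[Num.min/1]_t d t) => [|t].
  by apply/lt_bigmin.
by apply: (Pmono _ _ _ _ (Pd t)); exact: bigmin_le.
Qed.

(** * Compactness of the unit ball and its consequence in a fixed space *)

Section Compactness.
Local Open Scope classical_set_scope.

Lemma closed_forall {T : topologicalType} {I : Type} (P : I -> set T) :
  (forall i, closed (P i)) -> closed [set y | forall i, P i y].
Proof.
move=> cP y cly i; apply: cP => B /cly[z [Pz Bz]].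
by exists z; split => //; exact: Pz.
Qed.

Lemma continuous_sumr {R : realType} {T : topologicalType}
    {V : normedModType R} {I : Type} (r : seq I) (P : pred I) (f : I -> T -> V) :
  (forall i, continuous (f i)) ->
  continuous (fun x => \sum_(i <- r | P i) f i x).
Proof.
move=> cf x; apply: (@cvg_big V I +%R 0 P) => [|i _]; last exact: cf.
exact: add_continuous.
Qed.

Lemma continuous_normr {R : realType} {T : topologicalType}
    {V : normedModType R} (f : T -> V) :
  continuous f -> continuous (fun x => `|f x|).
Proof. by move=> cf x; exact: cvg_norm (cf x). Qed.

Lemma closed_le_fun {R : realType} {T : topologicalType} (f : T -> R) (c : R) :
  continuous f -> closed [set y | f y <= c].
Proof. by move=> /continuous_closedP/(_ _ (@closed_le R c)). Qed.

Lemma closed_ge_fun {R : realType} {T : topologicalType} (f : T -> R) (c : R) :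
  continuous f -> closed [set y | c <= f y].
Proof. by move=> /continuous_closedP/(_ _ (@closed_ge R c)). Qed.

(* Points of the compact set [M4 Y] at distance at least [e] from every
   maximiser of [|\sum_(i in A) y i|] form a compact set, on which the norm of
   the sum stays away from its maximal value [#|A|]. *)
Lemma compact_perturbable {R : realType} (Y : normedModType R) (e : R)
    (A : {set 'I_4}) :
  compact (@unit_ball R Y) -> 0 < e ->
  exists2 d : R, 0 < d & perturbable Y e d A.
Proof.
move=> cY e0.
pose T : topologicalType := prod_topology (fun _ : 'I_4 => Y).
pose G (y : T) := `|\sum_(i in A) y i|.
pose F := [set b : T | M4 Y b /\ G b = #|A|%:R].
pose dist (b y : T) := \sum_i `|b i - y i|.
have near_maximiser (b y : T) : F b -> dist b y < e ->
    exists z, [/\ M4 Y z, (forall i, `|z i - y i| < e) & G z = #|A|%:R].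
  move=> [Mb Gb] by_e; exists b; split => // i; apply: le_lt_trans by_e.
  by rewrite /dist (bigD1 i)//= lerDl sumr_ge0.
pose K := [set y : T | M4 Y y /\ forall b, F b -> e <= dist b y].
have proj i : continuous (fun y : T => y i).
  exact: (@proj_continuous _ (fun=> Y) i).
have cG : continuous G.
  by apply: continuous_normr; exact: continuous_sumr.
have cdist b : continuous (dist b).
  apply: (@continuous_sumr R T R) => i; apply: continuous_normr => y.
  exact: cvgB (cvg_cst _) (proj i y).
have clK : closed K.
  apply: closedI; first apply: closedI.
  - apply: closed_forall => i; apply: closed_le_fun.
    exact: continuous_normr.
  - do 3 apply: closed_forall => ?; apply: closed_forall => _.
    apply: closed_le_fun; apply: continuous_normr => y.
    exact: cvgD (cvgB (proj _ y) (proj _ y)) (proj _ y).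
  - apply: closed_forall => b; apply: closed_forall => _.
    exact: closed_ge_fun.
have cK : compact K.
  apply: (subclosed_compact clK
    (@tychonoff _ (fun=> Y) (fun=> @unit_ball R Y) (fun=> cY))).
  by move=> y [[y1 _] _] i; exact: y1.
have [[k0 Kk0]|K0] := pselect (K !=set0); last first.
  exists 1 => // y My _.
  have [[b Fb bye]|nb] := pselect (exists2 b, F b & dist b y < e).
    exact: (near_maximiser b).
  exfalso; apply: K0; exists y; split => // b Fb; rewrite leNgt; apply/negP.
  by move=> bye; apply: nb; exists b.
have [a aK aM] : exists2 a, a \in K & forall t, t \in K -> G t <= G a.
  apply: compact_EVT_max => //; first by exists k0.
  exact: continuous_subspaceT.
(* The gap is positive: if [G a] were [#|A|], then [a] would be a maximiser at distance [0] from
   itself, contrary to [a] being in [K]. *)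
move: aK; rewrite inE => -[Ma aF]; exists (#|A|%:R - G a).
  rewrite subr_gt0 lt_neqAle M4_sum_le// andbT; apply/eqP => Ga.
  have := aF a (conj Ma Ga); rewrite leNgt.
  by rewrite [dist _ _]big1 ?e0// => i _; rewrite subrr normr0.
move=> y My; rewrite subKr => Gy.
have [[b Fb bye]|nb] := pselect (exists2 b, F b & dist b y < e).
  exact: (near_maximiser b).
suff Ky : y \in K by move: Gy; rewrite ltNge aM.
rewrite inE; split => // b Fb; rewrite leNgt; apply/negP.
by move=> bye; apply: nb; exists b.
Qed.

(** The identity [f] from the sup norm to the $\ell_1$-norm is continuous, and the ball is the image
    of a set closed and bounded for the sup norm. *)
Lemma ell1n_ball_compact (R : realType) (n : nat) :
  compact (@unit_ball R (ell1n R n)).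
Proof.
pose f : 'rV[R]_n -> ell1n R n := id.
have cf : continuous f.
  move=> x; apply/(@cvgrPdist_lt _ (ell1n R n) _ (nbhs x)) => e e0.
  have cg : continuous (fun y : 'rV[R]_n => \sum_i `|x ord0 i - y ord0 i|).
    apply: (@continuous_sumr R _ R) => i; apply: continuous_normr => y.
    exact: cvgB (cvg_cst _) (@coord_continuous R 1 n ord0 i y).
  have /cvgr_lt /(_ e) := cg x.
  rewrite big1 => [/(_ e0)|i _]; last by rewrite subrr normr0.
  apply: filterS => y; rewrite ell1n_normE; apply: le_lt_trans.
  by rewrite le_eqVlt; apply/orP; left; apply/eqP/eq_bigr => i _; rewrite !mxE.
have -> : @unit_ball R (ell1n R n) =
    f @` [set x : 'rV[R]_n | \sum_i `|x ord0 i| <= 1].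
  by apply/seteqP; split=> [x x1|_ [x x1 <-]//]; exists x.
apply: continuous_compact; first exact: continuous_subspaceT.
apply: bounded_closed_compact.
  exists 1; split => // M M1 x /= x1.
  rewrite [`|x|]mx_normrE; apply: bigmax_le => [|[i j] _ /=].
    by rewrite (le_trans _ (ltW M1)).
  rewrite (le_trans _ (ltW M1))// (le_trans _ x1)// ord1.
  by rewrite (bigD1 j)//= lerDl sumr_ge0.
apply: closed_le_fun; apply: (@continuous_sumr R _ R) => i.
by apply: continuous_normr; exact: coord_continuous.
Qed.

End Compactness.

(** * Merging coordinates into blocks *)

Section Blocks.
Context {R : realType} {n N : nat}.
Variables (c : 'I_n -> 'I_N) (m : 'I_n -> R).

Let sum_blocks (f : 'I_n -> R) : \sum_k f k = \sum_s \sum_(k | c k == s) f k.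
Proof. exact: partition_big. Qed.

Definition block_sum (x : ell1n R n) : ell1n R N :=
  \row_s \sum_(k | c k == s) x ord0 k.

Lemma block_sum_linear : linear block_sum.
Proof.
move=> a u v; apply/rowP => s; rewrite !mxE mulr_sumr -big_split/=.
by apply: eq_bigr => k _; rewrite !mxE.
Qed.

HB.instance Definition _ :=
  GRing.isLinear.Build R (ell1n R n) (ell1n R N) *:%R block_sum block_sum_linear.

Lemma block_sum_norm_le (x : ell1n R n) : `|block_sum x| <= `|x|.
Proof.
rewrite !ell1n_normE sum_blocks; apply: ler_sum => s _.
by rewrite mxE ler_norm_sum.
Qed.

(** Coordinates in one block have the same sign, so summing them causes no cancellation. *)
Lemma block_sum_norm (x : ell1n R n) :
  (forall k l, c k = c l -> (0 <= x ord0 k) = (0 <= x ord0 l)) ->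
  `|block_sum x| = `|x|.
Proof.
move=> sgn_x; rewrite !ell1n_normE sum_blocks; apply: eq_bigr => s _.
rewrite mxE; case: (pickP (fun k => c k == s)) => [k /eqP ks|none]; last first.
  by rewrite !big_pred0// normr0.
have sgn_s l : c l == s -> (0 <= x ord0 l) = (0 <= x ord0 k).
  by move=> /eqP ls; apply: sgn_x; rewrite ls ks.
have [xk|xk] := leP 0 (x ord0 k).
  rewrite ger0_norm; last by apply: sumr_ge0 => l /sgn_s ->.
  by apply: eq_bigr => l /sgn_s; rewrite xk => /ger0_norm.
have neg_s l : c l == s -> x ord0 l <= 0.
  by move=> /sgn_s; rewrite !leNgt xk => /negbFE/ltW; rewrite leNgt.
rewrite ler0_norm; last by apply: sumr_le0 => l /neg_s.
by rewrite -sumrN; apply: eq_bigr => l /neg_s/ler0_norm.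
Qed.

(** Each block value is spread over its block in proportion to the weights [m]. Applied after
    [block_sum], this replaces the ratios of coordinate to weight by their weighted averages over
    the blocks. *)
Definition block_lift (a : ell1n R N) : ell1n R n :=
  \row_k (m k / (\sum_(l | c l == c k) m l) * a ord0 (c k)).

Lemma block_lift_linear : linear block_lift.
Proof.
by move=> b u v; apply/rowP => k; rewrite !mxE mulrDr mulrCA.
Qed.

HB.instance Definition _ :=
  GRing.isLinear.Build R (ell1n R N) (ell1n R n) *:%R block_lift
    block_lift_linear.

Hypothesis m_gt0 : forall k, 0 < m k.

Let block_mass_gt0 k : 0 < \sum_(l | c l == c k) m l.
Proof.
by rewrite (bigD1 k)//= ltr_pwDl// sumr_ge0// => l _; rewrite ltW.
Qed.

(** The proportions in a block add up to [1]; surjectivity of [c] ensures that no entry of [a] is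
    lost to an empty block. *)
Lemma block_lift_norm (a : ell1n R N) :
  (forall s, exists k, c k = s) -> `|block_lift a| = `|a|.
Proof.
move=> c_surj; rewrite !ell1n_normE sum_blocks; apply: eq_bigr => s _.
rewrite (eq_bigr (fun k => m k * (`|a ord0 s| / \sum_(l | c l == s) m l))).
  have [k <-] := c_surj s.
  by rewrite -mulr_suml mulrCA divff ?mulr1// gt_eqF.
move=> k /eqP <-; rewrite mxE normrM ger0_norm ?mulrA ?(mulrAC _ `|_|)//.
by rewrite divr_ge0// ltW.
Qed.

Lemma block_lift_sum_close (h : R) (y : ell1n R n) :
  (forall k l, c k = c l -> `|y ord0 l / m l - y ord0 k / m k| <= h) ->
  `|block_lift (block_sum y) - y| <= h * \sum_k m k.
Proof.
move=> yh; rewrite ell1n_normE mulr_sumr; apply: ler_sum => k _.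
rewrite !mxE; set M := \sum_(l | _) m l.
have M0 : 0 < M by exact: block_mass_gt0.
(* Writing each coordinate as weight times ratio turns the error at [k] into [m k] times a weighted
   average of differences of ratios, each at most [h]. *)
have -> : m k / M * \sum_(l | c l == c k) y ord0 l - y ord0 k =
    m k / M * \sum_(l | c l == c k) m l * (y ord0 l / m l - y ord0 k / m k).
  rewrite [in RHS](eq_bigr (fun l => y ord0 l - m l * (y ord0 k / m k))).
    rewrite sumrB -mulr_suml mulrBr -/M; congr (_ - _).
    by field; rewrite !gt_eqF.
  by move=> l _; field; rewrite !gt_eqF.
rewrite normrM ger0_norm; last by rewrite divr_ge0// ltW.
apply: (@le_trans _ _ (m k / M * (M * h))); last first.
  by rewrite mulrA divfK ?gt_eqF// mulrC.
rewrite ler_wpM2l//; first by rewrite divr_ge0// ltW.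
rewrite (le_trans (ler_norm_sum _ _ _))// mulr_suml ler_sum// => l /eqP cl.
by rewrite normrM ger0_norm ?ler_wpM2l ?yh// ltW.
Qed.

End Blocks.

(** * Uniformity in the dimension *)

(** Numbering only the labels that occur makes [c] surjective and keeps [N] at most [#|T|], whatever
    [n] is. *)
Lemma surjective_relabelling {n : nat} {T : finType} (f : 'I_n -> T) :
  exists (N : 'I_#|T|.+1) (c : 'I_n -> 'I_N),
    (forall s, exists k, c k = s) /\ (forall k l, c k = c l -> f k = f l).
Proof.
pose S := f @: 'I_n.
have fS k : f k \in S by exact: imset_f.
have NT : (#|S| < #|T|.+1)%N by rewrite ltnS max_card.
exists (Ordinal NT), (fun k => enum_rank_in (fS k) (f k)); split => [s|k l kl].
  have /imsetP[k _ sk] := enum_valP s; exists k.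
  by apply: enum_val_inj; rewrite enum_rankK_in.
by rewrite -(enum_rankK_in (fS k) (fS k)) kl enum_rankK_in.
Qed.

(** The shift by [1] makes the scaled numbers nonnegative, where truncation is the floor; equal
    floors put them within [1] of each other. *)
Lemma truncn_scale_close {R : realType} (K : nat) (a b : R) :
  (0 < K)%N -> -1 <= a -> -1 <= b ->
  Num.truncn ((a + 1) * K%:R) = Num.truncn ((b + 1) * K%:R) ->
  `|a - b| <= K%:R^-1.
Proof.
move=> K0 a1 b1 ab.
have K0' : 0 < K%:R :> R by rewrite ltr0n.
have := @truncn_itv R ((a + 1) * K%:R); have := @truncn_itv R ((b + 1) * K%:R).
rewrite -ab !mulr_ge0 ?ler0n -?lerBlDr ?sub0r// -natr1.
move=> /(_ isT)/andP[tb bt] /(_ isT)/andP[ta at_].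
rewrite -(ler_pM2r K0') mulVf ?gt_eqF// -[X in _ * X](gtr0_norm K0') -normrM.
by rewrite ler_norml; apply/andP; split; lra.
Qed.

(* With [m k = 1/n + sum_i |y i k|], the ratios [y i k / m k] lie in [-1, 1].
   Coordinates are put in the same block when these ratios fall in the same cell
   of a grid of mesh [1/K] and [sum_(i in A) y i] has the same sign; the number
   of blocks is then bounded independently of [n]. *)
Lemma ell1n_perturbable {R : realType} (e : R) :
  0 < e ->
  exists2 d : R, 0 < d & forall n A, perturbable (ell1n R n) e d A.
Proof.
(* The weights below have total mass at most [5], so ratios known up to [1/K] cost an error of at
   most [5/K]. *)
move=> e0; pose K := (Num.truncn (10 / e)).+1.
have Ke : 5 / K%:R < e / 2.
  have := truncnS_gt (10 / e); rewrite -/K ltr_pdivrMr// => eK.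
  by rewrite ltr_pdivrMr ?ltr0n//; lra.
(* A label is a grid cell for each of the four ratios, and a sign. Ratios up to [1] allow the cell
   index [2 * K], whence [2 * K + 1] cells. *)
pose T : finType := ({ffun 'I_4 -> 'I_(2 * K).+1} * bool)%type.
have [d d0 Hd] : exists2 d : R, 0 < d &
    forall NA : 'I_#|T|.+1 * {set 'I_4},
      perturbable (ell1n R NA.1) (e / 2) d NA.2.
  apply: finite_uniform_bound => [t d d'|t]; first exact: perturbable_le.
  apply: compact_perturbable; last by rewrite divr_gt0.
  exact: ell1n_ball_compact.
exists d => // n A y My Ay.
(* The term [1/n] makes every weight positive and adds at most [1] to the total mass, to which each
   of the four vectors adds its norm. *)
pose m k := n%:R^-1 + \sum_i `|y i ord0 k|.
have ym i k : `|y i ord0 k| < m k.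
  have n0 : (0 < n)%N by case: (n) k => [[]|].
  rewrite /m (bigD1 i)//= addrCA ltrDl ltr_pwDl ?invr_gt0 ?ltr0n//.
  by rewrite sumr_ge0.
have m0 k : 0 < m k by exact: le_lt_trans (ym ord0 k).
have m5 : \sum_k m k <= 5.
  rewrite big_split/= exchange_big/= sumr_const card_ord.
  have -> : 5 = 1 + \sum_(i < 4) 1 :> R by rewrite sumr_const card_ord -mulrS.
  rewrite -[_^-1 *+ n]mulr_natr lerD//.
    have [->|n0] := posnP n; first by rewrite mulr0.
    by rewrite mulVf// pnatr_eq0 -lt0n.
  by rewrite ler_sum// => i _; case: My => /(_ i).
pose ratio i k := y i ord0 k / m k.
have ratio1 i k : -1 <= ratio i k <= 1.
  by rewrite -ler_norml normrM normfV (gtr0_norm (m0 k)) ler_pdivrMr// mul1r ltW.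
pose cell i k := Num.truncn ((ratio i k + 1) * K%:R).
have cellK i k : (cell i k < (2 * K).+1)%N.
  have /andP[r1 r2] := ratio1 i k.
  rewrite ltnS truncn_le_nat (@le_lt_trans _ _ (2 * K)%:R) ?ltr_nat//.
  by rewrite natrM ler_wpM2r//; lra.
pose label k : T := ([ffun i => inord (cell i k)],
  0 <= (\sum_(i in A) y i : ell1n R n) ord0 k).
have [N [c [c_surj c_label]]] := surjective_relabelling label.
have c_ratio i k l : c k = c l -> `|ratio i l - ratio i k| <= K%:R^-1.
  move=> /c_label [/ffunP/(_ i) + _]; rewrite !ffunE => /(congr1 val).
  rewrite /= !inordK// => kl; apply: truncn_scale_close => //.
  - by case/andP: (ratio1 i l).
  - by case/andP: (ratio1 i k).
rewrite [e]splitr.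
apply: (perturb_via (block_sum c) (block_lift c m) d (e / 2) (e / 2)) => //.
- exact: block_sum_norm_le.
- by move=> a; exact: block_lift_norm.
- exact: (Hd (N, A)).
(* The sign in the labels preserves the norm of the sum, hence the bound [Ay]. *)
- by rewrite block_sum_norm// => k l /c_label[].
- move=> i; apply: le_lt_trans Ke.
  rewrite (le_trans (block_lift_sum_close _ _ m0 _ _ (c_ratio i)))//.
  by rewrite mulrC ler_wpM2r.
Qed.

(** * Reduction of $\ell_1$ to $\ell_1^n$ *)

Section Truncation.
Local Open Scope classical_set_scope.
Local Open Scope ring_scope.
Context {R : realType}.

Definition ell1_trunc n (y : ell1 R) : ell1n R n := \row_k y k.

Lemma ell1_trunc_linear n : linear (ell1_trunc n).
Proof. by move=> a u v; apply/rowP => k; rewrite !mxE. Qed.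

HB.instance Definition _ n :=
  GRing.isLinear.Build R (ell1 R) (ell1n R n) *:%R (ell1_trunc n)
    (ell1_trunc_linear n).

Definition zero_ext {n} (x : ell1n R n) (k : nat) : R :=
  oapp (fun i => x ord0 i) 0 (insub k).

Lemma zero_ext_series {n} (x : ell1n R n) N :
  (n <= N)%N -> series (fun k => `|zero_ext x k|) N = `|x|.
Proof.
move=> nN; rewrite seriesEnat/= (big_cat_nat (leq0n n) nN)/= [X in _ + X]big1_seq.
  rewrite addr0 big_mkord ell1n_normE; apply: eq_bigr => i _.
  by rewrite /zero_ext valK.
move=> k; rewrite mem_index_iota => /andP[_ /andP[nk _]].
by rewrite /zero_ext insubF ?normr0// ltnNge nk.
Qed.

Lemma zero_ext_cvg {n} (x : ell1n R n) :
  series (fun k => `|zero_ext x k|) @ \oo --> `|x|.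
Proof.
apply: (@cvg_trans _ (cst `|x| @ \oo)); last exact: cvg_cst.
apply: near_eq_cvg; exists n => // N /= nN.
by rewrite zero_ext_series.
Qed.

Lemma zero_ext_summable {n} (x : ell1n R n) : zero_ext x \in abs_summable.
Proof. by apply/abs_summableP; exact: (cvgP _ (zero_ext_cvg x)). Qed.

Definition ell1_pad n (x : ell1n R n) : ell1 R := Ell1 (zero_ext_summable x).

Lemma ell1_pad_linear n : linear (@ell1_pad n).
Proof.
move=> a u v; apply/val_inj/funext => k.
change (zero_ext (a *: u + v) k = a * zero_ext u k + zero_ext v k).
rewrite /zero_ext; case: insubP => [i _ _|_] /=; first by rewrite !mxE.
by rewrite mulr0 addr0.
Qed.

HB.instance Definition _ n :=
  GRing.isLinear.Build R (ell1n R n) (ell1 R) *:%R (@ell1_pad n)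
    (@ell1_pad_linear n).

Lemma ell1_pad_norm n (x : ell1n R n) : `|ell1_pad n x| = `|x|.
Proof. by rewrite ell1_normE; apply: cvg_lim => //; exact: zero_ext_cvg. Qed.

Lemma ell1_padK n (x : ell1n R n) : ell1_trunc n (ell1_pad n x) = x.
Proof. by apply/rowP => i; rewrite mxE /= /zero_ext valK. Qed.

Lemma ell1_trunc_norm n (y : ell1 R) :
  `|ell1_trunc n y| = series (fun k => `|y k|) n.
Proof.
rewrite ell1n_normE seriesEnat/= big_mkord.
by apply: eq_bigr => i _; rewrite mxE.
Qed.

Lemma ell1_trunc_norm_cvg (y : ell1 R) :
  `|ell1_trunc n y| @[n --> \oo] --> `|y|.
Proof.
under eq_fun do rewrite ell1_trunc_norm.
exact: ell1_cvg.
Qed.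

(** The truncation and the tail have disjoint supports, so their norms add up to that of [y]. *)
Lemma ell1_pad_trunc_dist n (y : ell1 R) :
  `|ell1_pad n (ell1_trunc n y) - y| = `|y| - `|ell1_trunc n y|.
Proof.
apply/eqP; rewrite eq_sym subr_eq -(ell1_pad_norm n (ell1_trunc n y)).
rewrite !ell1_normE -lim_seriesD; [|exact: ell1_cvg..].
apply/eqP; congr (limn (series _)); apply/funext => k.
change (`|y k| =
  `|zero_ext (ell1_trunc n y) k - y k| + `|zero_ext (ell1_trunc n y) k|).
rewrite /zero_ext; case: insubP => [i _ <-|_] /=.
  by rewrite mxE subrr normr0 add0r.
by rewrite sub0r normrN normr0 addr0.
Qed.

Lemma ell1_trunc_norm_le n (y : ell1 R) : `|ell1_trunc n y| <= `|y|.
Proof. by rewrite -subr_ge0 -ell1_pad_trunc_dist. Qed.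

(** Norms of truncations converge, so one [n] suits the sum and all four vectors. It depends on [y],
    which is harmless because [d] is common to all dimensions. *)
Lemma ell1_perturbable (e d : R) (A : {set 'I_4}) :
  0 < e -> (forall n, perturbable (ell1n R n) (e / 2) d A) ->
  perturbable (ell1 R) e d A.
Proof.
move=> e0 Hn y My Ay; have e20 : 0 < e / 2 by rewrite divr_gt0.
have [n [nA ne]] : exists n, #|A|%:R - d < `|ell1_trunc n (\sum_(i in A) y i)|
    /\ forall i, `|ell1_pad n (ell1_trunc n (y i)) - y i| < e / 2.
  have nearA : \forall n \near \oo,
      #|A|%:R - d < `|ell1_trunc n (\sum_(i in A) y i)|.
    by apply: cvgr_gt Ay; exact: ell1_trunc_norm_cvg.
  have neary : \forall n \near \oo, forall i,
      `|y i| - e / 2 < `|ell1_trunc n (y i)|.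
    apply: filter_forall => i.
    apply: (cvgr_gt _ (ell1_trunc_norm_cvg (y i))).
    by rewrite gtrBl.
  have [n [nA ny]] := filter_ex (filterI nearA neary).
  exists n; split => // i; rewrite ell1_pad_trunc_dist.
  by have := ny i; lra.
rewrite [e]splitr.
apply: (perturb_via (ell1_trunc n) (ell1_pad n) d (e / 2) (e / 2)) => //.
- exact: ell1_trunc_norm_le.
- exact: ell1_pad_norm.
- exact: Hn.
Qed.

End Truncation.

(** * The dual sphere as norming set *)

Section DualSphere.
Context {R : realType} {Y : normedModType R}.

Lemma dual_norm_bound (f : {linear Y -> R}) (y : Y) :
  continuous f -> `|f y| <= dual_norm f * `|y|.
Proof.
move=> cf; have [->|y0] := eqVneq y 0; first by rewrite linear0 !normr0 mulr0.
have ny0 : 0 < `|y| by rewrite normr_gt0.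
have f_unit : `|f y| / `|y| = `|f (`|y|^-1 *: y)|.
  by rewrite linearZ normrM normfV normr_id mulrC.
rewrite -ler_pdivrMr// f_unit.
have /linear_bounded_continuous/linear_boundedP/pinfty_ex_gt0[r r0 fr] := cf.
apply: ub_le_sup.
  exists r => _ [x x1 <-]; rewrite (le_trans (fr x))//.
  by rewrite ger_pMr.
exists (`|y|^-1 *: y) => //=.
by rewrite /unit_ball/= normrZ normfV normr_id mulVf// gt_eqF.
Qed.

Lemma dual_sphere_bound (f : {linear Y -> R}) (y : Y) :
  dual_sphere f -> `|f y| <= `|y|.
Proof.
by move=> [cf f1]; rewrite (le_trans (dual_norm_bound _ _ cf))// f1 mul1r.
Qed.

Lemma dual_sphereI (f : {linear Y -> R}) (x : Y) :
  (forall y, `|f y| <= `|y|) -> `|x| <= 1 -> `|f x| = 1 -> dual_sphere f.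
Proof.
move=> f1 x1 fx; split.
  apply/linear_bounded_continuous/linear_boundedP; near=> r => y.
  by rewrite (le_trans (f1 y))// ler_peMl//; near: r; exact: nbhs_pinfty_ge.
have ub : ubound [set `|f y| | y in @unit_ball R Y]%classic 1.
  by move=> _ [y y1 <-]; exact: le_trans (f1 y) y1.
apply/eqP; rewrite eq_le; apply/andP; split.
  by apply: ge_sup => //; exists 1, x.
by apply: ub_le_sup; [exists 1|exists x].
Unshelve. all: by end_near. Qed.

Lemma dual_sphere_one_norming :
  (forall (y : Y) (e : R), 0 < e ->
     exists2 f : {linear Y -> R}, dual_sphere f & `|y| - e < `|f y|) ->
  one_norming (dual_sphere (Y := Y)).
Proof.
move=> norming; split => [f [cf f1]|y]; first by split => //; rewrite f1.
have ub : ubound [set `|f y| | f in dual_sphere (Y := Y)]%classic `|y|.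
  by move=> _ [f Sf <-]; exact: dual_sphere_bound.
have [f0 Sf0 _] := norming y 1 ltr01.
apply/eqP; rewrite eq_le; apply/andP; split; last first.
  by apply: ge_sup => //; exists `|f0 y|, f0.
apply/ler_addgt0Pr => e e0; have [f Sf fy] := norming y e e0.
rewrite -lerBlDr (le_trans (ltW fy))//.
by apply: ub_le_sup; [exists (`|y|) | exists f].
Qed.

(** Since [A] has at most four elements, evaluating [f] at the sum bounds its norm below by
    [#|A| - 4 * rho e], which exceeds [#|A| - d e]. *)
Lemma perturbable_hyperplane_sum (d rho : R -> R) :
  (forall e, 0 < e < 1 -> 4 * rho e < d e) ->
  (forall e, 0 < e < 1 -> 0 < rho e) ->
  (forall e A, 0 < e < 1 -> perturbable Y e (d e) A) ->
  approx_hyperplane_sum (dual_sphere (Y := Y)) rho.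
Proof.
move=> rho_d rho0 HY e e01 y My A _ f Sf fy; apply: (HY e A e01 y My).
apply: (lt_le_trans _ (le_trans (ler_norm _) (dual_sphere_bound _ _ Sf))).
rewrite linear_sum.
apply: (@lt_le_trans _ _ (\sum_(i in A) (1 - rho e))); last first.
  by apply: ler_sum => i iA; rewrite ltW// fy.
rewrite sumr_const mulrnBl ltrD2l ltrN2 -[_ *+ _]mulr_natl.
apply: le_lt_trans (rho_d _ e01); rewrite ler_pM2r ?rho0// ler_nat.
by rewrite -[leqRHS]card_ord max_card.
Qed.

End DualSphere.

(** * Sign functionals *)

Section SignFunctional.
Context {R : realType} {n : nat}.
Variable s : 'I_n -> bool.

Definition sign_form (x : ell1n R n) : R := \sum_k (-1) ^+ s k * x ord0 k.

Lemma sign_form_linear : linear sign_form.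
Proof.
move=> a u v; rewrite /sign_form scaler_sumr -big_split/=; apply: eq_bigr => k _.
by rewrite !mxE mulrDr mulrCA.
Qed.

HB.instance Definition _ :=
  GRing.isLinear.Build R (ell1n R n) R *:%R sign_form sign_form_linear.

Lemma sign_form_bound (x : ell1n R n) : `|sign_form x| <= `|x|.
Proof.
rewrite ell1n_normE (le_trans (ler_norm_sum _ _ _))// ler_sum// => k _.
by rewrite normrMsign.
Qed.

Lemma sign_form_basis (k : 'I_n) :
  exists x : ell1n R n, `|x| = 1 /\ `|sign_form x| = 1.
Proof.
exists (delta_mx ord0 k); split.
  rewrite ell1n_normE (bigD1 k)//= mxE !eqxx normr1 big1 ?addr0// => i ik.
  by rewrite mxE (negbTE ik) andbF normr0.
rewrite /sign_form (bigD1 k)//= mxE !eqxx big1.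
  by rewrite addr0 normrMsign normr1.
by move=> i ik; rewrite mxE (negbTE ik) andbF mulr0.
Qed.

End SignFunctional.

Lemma sign_form_norming {R : realType} {n : nat} (x : ell1n R n) :
  sign_form (fun k => x ord0 k < 0) x = `|x|.
Proof. by rewrite ell1n_normE; apply: eq_bigr => k _; rewrite -normrEsign. Qed.

Lemma ell1n_one_norming (R : realType) (n : nat) :
  (0 < n)%N -> one_norming (dual_sphere (Y := ell1n R n)).
Proof.
move=> n0; apply: dual_sphere_one_norming => y e e0.
exists (sign_form (fun k => y ord0 k < 0) : {linear _ -> _}).
  have [x [x1 sx]] := @sign_form_basis R _ (fun k => y ord0 k < 0) (Ordinal n0).
  by apply: (dual_sphereI _ x) => //; [exact: sign_form_bound|rewrite x1].
by rewrite /= sign_form_norming normr_id gtrBl.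
Qed.

Lemma ell1_one_norming (R : realType) :
  one_norming (dual_sphere (Y := ell1 R)).
Proof.
apply: dual_sphere_one_norming => y e e0.
have : (\forall n \near \oo, `|y| - e < `|ell1_trunc n y|)%classic.
  by apply: (cvgr_gt _ (ell1_trunc_norm_cvg y)); rewrite gtrBl.
(* Length [N.+1] guarantees a coordinate [ord0], hence a unit vector. *)
move=> [N _ /(_ N.+1 (leqnSn N))/= yN].
set s := fun k => ell1_trunc N.+1 y ord0 k < 0.
exists (sign_form s \o ell1_trunc N.+1 : {linear _ -> _}).
  have [x [x1 sx]] := @sign_form_basis R _ s ord0.
  apply: (dual_sphereI _ (ell1_pad N.+1 x)) => [z||] /=.
  - by rewrite (le_trans (sign_form_bound _ _))// ell1_trunc_norm_le.
  - by rewrite ell1_pad_norm x1.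
  - by rewrite ell1_padK.
by rewrite /= sign_form_norming normr_id.
Qed.


(** * Choice of the common function *)

Local Open Scope ring_scope.

Theorem proposition4p6 (R : realType) :
  (exists rho : R -> R,
    [/\ forall e : R, 0 < e < 1 -> 0 < rho e < e,
        forall n : nat, (0 < n)%N ->
          norming_approx_hyperplane_sum (ell1n R n) rho
      & norming_approx_hyperplane_sum (ell1 R) rho])
  /\
  (exists gamma : R -> R,
    (forall n : nat, (0 < n)%N -> AHSp_linfty4 (ell1n R n) gamma)
    /\ AHSp_linfty4 (ell1 R) gamma).

Proof.
(* Tolerance [e / 2] in finite dimension is what [ell1_perturbable] turns into [e] in $\ell_1$; for
   [e <= 0] the value [0] is a dummy. *)
have /choice[d Hd] : forall e : R, exists d, 0 < e -> 0 < d /\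
    forall n A, perturbable (ell1n R n) (e / 2) d A.
  move=> e; have [e0|e0] := ltP 0 e; last by exists 0 => e0'; lra.
  have [|d d0 Hd] := @ell1n_perturbable R (e / 2); first by rewrite divr_gt0.
  by exists d.
(* The divisor [5] gives [4 * rho e < d e], and [e / 2] gives [rho e < e]. *)
pose rho e := Num.min (d e / 5) (e / 2).
have e_gt0 (e : R) : 0 < e < 1 -> 0 < e by case/andP.
have rho0 e : 0 < e < 1 -> 0 < rho e.
  by move=> /e_gt0 e0; have [d0 _] := Hd e e0; rewrite lt_min !divr_gt0.
have rho_e e : 0 < e < 1 -> 0 < rho e < e.
  move=> e01; rewrite rho0//= gt_min; apply/orP; right.
  by have := e_gt0 _ e01; lra.
have rho_d e : 0 < e < 1 -> 4 * rho e < d e.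
  move=> /e_gt0 e0; have [d0 _] := Hd e e0.
  have : rho e <= d e / 5 by rewrite ge_min lexx.
  by lra.
have Hn n : approx_hyperplane_sum (dual_sphere (Y := ell1n R n)) rho.
  apply: (perturbable_hyperplane_sum d) => // e A /e_gt0 e0 y My Ay.
  have [d0 Hde] := Hd e e0.
  have [z [Mz zy Az]] := Hde n A y My Ay.
  by exists z; split => // i; apply: lt_trans (zy i) _; lra.
have Hell1 : approx_hyperplane_sum (dual_sphere (Y := ell1 R)) rho.
  apply: (perturbable_hyperplane_sum d) => // e A /e_gt0 e0.
  by apply: ell1_perturbable => // n; have [_] := Hd e e0; exact.
(* The same [rho] serves as [gamma], since the norming set is the whole dual sphere. *)
split; exists rho.
  split => // [n n0|]; exists (dual_sphere (Y := _)).
    by split => //; exact: ell1n_one_norming.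
  by split => //; exact: ell1_one_norming.
by split => // n n0; split.
Qed.
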